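(* Let $\eta=Au^*+z\in\mathbb{R}^m$, where $A\in\mathbb{R}^{m\times k}$ is a random matrix with rows $a_1^T,\dots,a_m^T$, $u^*\in\mathbb{R}^k$, and $z\in\mathbb{R}^m$ is a random vector independent of $A$ whose entries are independent with $z_i\sim(1-\epsilon)\delta_0+\epsilon Q_i$ for $i=1,\dots,m$, where $\epsilon\in[0,1)$ and $Q_1,\dots,Q_m$ are arbitrary probability distributions on $\mathbb{R}$. Let $\widehat u\in\operatorname{argmin}_{u\in\mathbb{R}^k}\|\eta-Au\|_1$. Assume that there are numbers $\sigma\ge 0$, $\underline\lambda>0$, $\overline\lambda>0$ such that: (A) for any fixed (non-random) $c_1,\dots,c_m$ with $\max_i|c_i|\le 1$, one has $\left\|\frac1m\sum_{i=1}^m c_ia_i\right\|^2\le\frac{\sigma^2k}{m}$ with high probability; (B) with high probability, $\inf_{\|\Delta\|=1}\frac1m\sum_{i=1}^m|a_i^T\Delta|\ge\underline\lambda$ and $\sup_{\|\Delta\|=1}\frac1m\sum_{i=1}^m|a_i^T\Delta|^2\le\overline\lambda^2$ (infimum and supremum over $\Delta\in\mathbb{R}^k$). Then, if $$\frac{\overline\lambda\sqrt{\frac km\log\left(\frac{em}{k}\right)}+\epsilon\sigma\sqrt{\frac km}}{\underline\lambda(1-\epsilon)}$$ is sufficiently small, $\widehat u=u^*$ with high probability.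
   Context: $\|\cdot\|$ is the Euclidean norm, $\|\cdot\|_1$ the $\ell_1$ norm, $\delta_0$ the point mass at $0$. Convention for ''with high probability'' and ''sufficiently small'': for every $\delta\in(0,1)$ there exist $\delta_0'\in(0,1)$ and $c>0$ depending only on $\delta$ such that, if the events in (A) (for each fixed $(c_i)$) and (B) each have probability at least $1-\delta_0'$ and the displayed ratio is at most $c$, then the conclusion holds with probability at least $1-\delta$. *)

(* Defs.v *)
From HB Require Import structures.
From mathcomp Require Export all_boot all_order all_algebra.
From mathcomp Require Export all_classical all_reals all_analysis.
Export Order.TTheory GRing.Theory Num.Theory.
Export numFieldNormedType.Exports.

Set Implicit Arguments.
Unset Strict Implicit.
Unset Printing Implicit Defensive.

Local Open Scope classical_set_scope.
Local Open Scope ring_scope.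

(* The norm `|v| that the library puts on matrices is the sup norm, hence the
   two norms below. *)
Definition l2norm (R : realType) (n : nat) (v : 'cV[R]_n) : R :=
  Num.sqrt (\sum_(i < n) v i 0 ^+ 2).

Definition l1norm (R : realType) (n : nat) (v : 'cV[R]_n) : R :=
  \sum_(i < n) `|v i 0|.

Definition unit_sphere (R : realType) (n : nat) : set 'cV[R]_n :=
  [set v | l2norm v = 1].
Arguments unit_sphere : clear implicits.

Definition argmin (R : realType) (U : Type) (f : U -> R) : set U :=
  [set u | forall v, f u <= f v].

(* The event E has probability at least p.  For measurable E this is
   p%:E <= P E; for an E that need not be measurable (such as an event about an
   arbitrary selection of minimizers) it asks for a measurable subset of E of
   probability at least p. *)
Definition prob_ge (d : measure_display) (T : measurableType d) (R : realType)
    (P : probability T R) (E : set T) (p : R) : Prop :=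
  exists F : set T, [/\ measurable F, F `<=` E & (p%:E <= P F)%E].

Definition random_mx (d : measure_display) (T : measurableType d)
    (R : realType) (m n : nat) (X : T -> 'M[R]_(m, n)) : Prop :=
  forall i j, measurable_fun [set: T] (fun w => X w i j : measurableTypeR R).

(* The sigma-algebra on T generated by the entries of X, i.e. by X for the Borel
   sigma-algebra on matrices. *)
Definition sigma_mx (d : measure_display) (T : measurableType d)
    (R : realType) (m n : nat) (X : T -> 'M[R]_(m, n)) : set (set T) :=
  <<s \bigcup_(ij in [set: 'I_m * 'I_n])
        g_sigma_algebra_preimage
          (fun w => X w ij.1 ij.2 : measurableTypeR R) >>.

Definition independent_mx (d : measure_display) (T : measurableType d)
    (R : realType) (P : probability T R) (m n p q : nat)
    (X : T -> 'M[R]_(m, n)) (Y : T -> 'M[R]_(p, q)) : Prop :=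
  forall E F : set T, sigma_mx X E -> sigma_mx Y F ->
    P (E `&` F) = (P E * P F)%E.

Definition mutually_independent (d : measure_display) (T : measurableType d)
    (R : realType) (P : probability T R) (n : nat)
    (X : 'I_n -> T -> R) : Prop :=
  forall (J : {set 'I_n}) (B : 'I_n -> set (measurableTypeR R)),
    (forall i, measurable (B i)) ->
    P (\bigcap_(i in [set` J]) (X i @^-1` B i)) =
    (\prod_(i in J) P (X i @^-1` B i))%E.

(* The law of X is the mixture (1 - eps) delta_0 + eps Q. *)
Definition contaminated_law (d : measure_display) (T : measurableType d)
    (R : realType) (P : probability T R) (X : T -> R) (eps : R)
    (Q : probability (measurableTypeR R) R) : Prop :=
  forall B : set (measurableTypeR R), measurable B ->
    P (X @^-1` B) = ((1 - eps)%:E * \d_(0%R : R) B + eps%:E * Q B)%E.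

(* Main.v *)
(* Only the signs of the noise matter: if s_i is the sign of z_i, the one-sided
   derivative of u |-> l1norm (eta - A u) at ustar in the direction D is the sum
   of |a_i D| over s_i = 0 minus the sum of s_i a_i D, and ustar is the unique
   minimizer as soon as it is positive for every unit D.  Conditionally on A its
   mean is at least m ((1 - eps) lam_lo - eps sigma sqrt(k/m)), by (B) and by (A)
   for the coefficients E_{Q_i} sgn.  It is a sum of 1-Lipschitz functions of
   a_i D with independent random choices, so symmetrization and contraction bound
   the expected supremum of its fluctuation by
   2 E |sum_i e_i a_i| <= 2 (sum_i |a_i|^2)^(1/2) <= 2 m lam_hi sqrt(k/m)
   with Rademacher signs e_i; Markov's inequality concludes.  The hypothesis
   (B) forces k <= m, hence log(em/k) >= 1.  As s takes finitely many values,
   conditioning on A is a finite sum. *)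
Require Import Defs.
From mathcomp Require Import ring lra measurable_realfun.

Set Implicit Arguments.
Unset Strict Implicit.
Unset Printing Implicit Defensive.

Local Open Scope classical_set_scope.
Local Open Scope ring_scope.

(** * Maxima over finite families and expectations under finite product laws *)

(** The index [j0] witnesses that [J] is inhabited. The value is attained at some index by
    construction, so a bound valid for every [F j] applies to it directly. *)
Definition fmax (R : realFieldType) (J : finType) (j0 : J) (F : J -> R) : R :=
  F [arg max_(j > j0) F j]%O.

Lemma fmax_ge (R : realFieldType) (J : finType) (j0 : J) (F : J -> R) (j : J) :
  F j <= fmax j0 F.
Proof. by rewrite /fmax; case: arg_maxP => // i _; apply. Qed.

Lemma fmax_le (R : realFieldType) (J : finType) (j0 : J) (F : J -> R) (M : R) :
  (forall j, F j <= M) -> fmax j0 F <= M.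
Proof. by move=> FM; exact: FM. Qed.

Lemma fmaxD_le (R : realFieldType) (J : finType) (j0 : J) (F G : J -> R)
    (M : R) :
  (forall j l, F j + G l <= M) -> fmax j0 F + fmax j0 G <= M.
Proof. by move=> FGM; exact: FGM. Qed.

Definition upd (I : finType) (S : Type) (f : {ffun I -> S}) (i : I) (s : S) :
  {ffun I -> S} := [ffun j => if j == i then s else f j].

(** Mean of [G] over independent coordinates [f i] with laws [p i]. Nonnegativity and total mass 1
    of the weights are hypotheses of the lemmas that need them. *)
Definition expect (R : realFieldType) (I S : finType) (p : I -> S -> R)
    (G : {ffun I -> S} -> R) : R :=
  \sum_(f : {ffun I -> S}) (\prod_i p i (f i)) * G f.

Lemma expect_le (R : realFieldType) (I S : finType) (p : I -> S -> R)
    (G H : {ffun I -> S} -> R) :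
  (forall i s, 0 <= p i s) -> (forall f, G f <= H f) ->
  expect p G <= expect p H.
Proof.
move=> p0 GH; apply: ler_sum => f _; apply: ler_wpM2l => //.
exact: prodr_ge0.
Qed.

Lemma eq_expect (R : realFieldType) (I S : finType) (p : I -> S -> R)
    (G H : {ffun I -> S} -> R) :
  G =1 H -> expect p G = expect p H.
Proof. by move=> GH; apply: eq_bigr => f _; rewrite GH. Qed.

Lemma expectD (R : realFieldType) (I S : finType) (p : I -> S -> R)
    (G H : {ffun I -> S} -> R) :
  expect p (fun f => G f + H f) = expect p G + expect p H.
Proof. by rewrite -big_split; apply: eq_bigr => f _; rewrite mulrDr. Qed.

Lemma expectZ (R : realFieldType) (I S : finType) (p : I -> S -> R) (a : R)
    (G : {ffun I -> S} -> R) :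
  expect p (fun f => a * G f) = a * expect p G.
Proof. by rewrite mulr_sumr; apply: eq_bigr => f _; rewrite mulrCA. Qed.

Lemma expect_sum (R : realFieldType) (I S K : finType) (p : I -> S -> R)
    (G : K -> {ffun I -> S} -> R) :
  expect p (fun f => \sum_k G k f) = \sum_k expect p (G k).
Proof.
rewrite exchange_big /=; apply: eq_bigr => f _.
by rewrite mulr_sumr.
Qed.

Lemma expect_cst (R : realFieldType) (I S : finType) (p : I -> S -> R) (a : R) :
  (forall i, \sum_s p i s = 1) -> expect p (fun=> a) = a.
Proof.
move=> p1; rewrite /expect -mulr_suml.
rewrite -(bigA_distr_bigA (fun i s => p i s)) big1 ?mul1r //.
Qed.

(* Swapping (f, s) with (upd f i s, f i) is a weight-preserving involution. *)
Lemma expect_resample (R : realFieldType) (I S : finType) (p : I -> S -> R)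
    (i : I) (G : {ffun I -> S} -> R) :
  (forall i, \sum_s p i s = 1) ->
  expect p G = expect p (fun f => \sum_s p i s * G (upd f i s)).
Proof.
move=> p1; rewrite /expect.
under [RHS]eq_bigr => f _ do rewrite mulr_sumr.
rewrite pair_big /=.
pose sw (x : {ffun I -> S} * S) := (upd x.1 i x.2, x.1 i).
have swK : involutive sw.
  move=> [f s]; rewrite /sw /= ffunE eqxx; congr (_, _).
  by apply/ffunP => j; rewrite !ffunE; case: eqP => // ->.
rewrite (reindex_inj (inv_inj swK)) /=.
(* A factor 1, written as the total mass of [p i], makes the left side a sum over pairs (f, s)
   too. *)
under [LHS]eq_bigr => f _ do rewrite -[_ * G f]mulr1 -[X in _ * X](p1 i) mulr_sumr.
rewrite pair_big /=; apply: eq_bigr => -[f s] _ /=.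
have -> : upd (upd f i s) i (f i) = f by have := swK (f, s) => -[].
rewrite (bigD1 i) //= [in RHS](bigD1 i) //= ffunE eqxx.
rewrite [in RHS](eq_bigr (fun j => p j (f j))); last first.
  by move=> j /negPf ji; rewrite ffunE ji.
by ring.
Qed.

(** * Symmetrization, contraction and Rademacher sums *)

(* Symmetrization and contraction in one step: after averaging over a pair
   (s, r) and its swap, the sum of the two maxima is
   [h x + h y + (phi r - phi s) (t x) - (phi r - phi s) (t y)] for some x and y,
   hence at most [h x + h y + 2 `|t x - t y|]. *)
Lemma contraction1 (R : realFieldType) (J S : finType) (j0 : J) (h t : J -> R)
    (p : S -> R) (phi : S -> R -> R) :
  (forall s, 0 <= p s) -> \sum_s p s = 1 ->
  (forall s x y, phi s x - phi s y <= `|x - y|) ->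
  \sum_s p s * fmax j0 (fun j => h j + (\sum_r p r * phi r (t j) - phi s (t j)))
  <= \sum_(b : bool) 2^-1 * fmax j0 (fun j => h j + 2 * (-1) ^+ b * t j).
Proof.
move=> p0 p1 lip.
pose K s r := fmax j0 (fun j => h j + (phi r (t j) - phi s (t j))).
set V := leRHS.
have KV s r : K s r + K r s <= 2 * V.
  rewrite /K /V big_bool /=; apply: fmaxD_le => x y.
  have P1 := fmax_ge j0 (fun j => h j + 2 * (-1) ^+ true * t j).
  have P2 := fmax_ge j0 (fun j => h j + 2 * (-1) ^+ false * t j).
  rewrite /= expr0 expr1 in P1 P2 *.
  have l1 := lip r (t x) (t y); have l2 := lip s (t y) (t x).
  rewrite distrC in l2.
  (* The sign of [t x - t y] decides which of the maxima, with [+2t] or with [-2t], is tested at [x]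
     and which at [y]. *)
  have [txy|txy] := lerP 0 (t x - t y).
    rewrite (ger0_norm txy) in l1 l2.
    by have := P1 y; have := P2 x; lra.
  rewrite (ltr0_norm txy) in l1 l2.
  by have := P1 x; have := P2 y; lra.
(* Here [r] is an independent copy of [s]: the maximum of an average over [r] is at most the average
   of the maxima. *)
have step s : fmax j0 (fun j => h j + (\sum_r p r * phi r (t j) - phi s (t j)))
    <= \sum_r p r * K s r.
  apply: fmax_le => x.
  have -> : h x + (\sum_r p r * phi r (t x) - phi s (t x)) =
      \sum_r p r * (h x + (phi r (t x) - phi s (t x))).
    under [RHS]eq_bigr => r _ do rewrite addrCA mulrDr.
    by rewrite big_split /= -mulr_suml p1 mul1r; ring.
  apply: ler_sum => r _; apply: ler_wpM2l => //.
  exact: (fmax_ge j0 (fun j => h j + (phi r (t j) - phi s (t j)))).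
have le1 : \sum_s p s * fmax j0
    (fun j => h j + (\sum_r p r * phi r (t j) - phi s (t j)))
    <= \sum_s \sum_r p s * p r * K s r.
  apply: ler_sum => s _; under [leRHS]eq_bigr => r _ do rewrite -mulrA.
  by rewrite -mulr_sumr; exact: ler_wpM2l.
apply: (le_trans le1).
set W := leLHS.
have W2 : W + W <= 2 * V.
  rewrite {2}/W exchange_big -big_split /=.
  have -> : 2 * V = \sum_s \sum_r p s * p r * (2 * V).
    under eq_bigr => s _ do rewrite -mulr_suml -mulr_sumr p1 mulr1.
    by rewrite -mulr_suml p1 mul1r.
  apply: ler_sum => s _; rewrite -big_split; apply: ler_sum => r _ /=.
  rewrite (mulrC (p r)) -mulrDr; apply: ler_wpM2l => //.
  exact: mulr_ge0.
by lra.
Qed.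

Lemma sum_bool_half (R : realFieldType) : \sum_(b : bool) (2^-1 : R) = 1.
Proof. by rewrite big_bool /=; lra. Qed.

(** The coordinates are exchanged one at a time. [X r] is the hybrid process in which the indices in
    [r] already carry Rademacher signs, and [V r], its expected maximum, does not decrease when an
    index is added to [r]. *)
Lemma contraction (R : realFieldType) (I J S : finType) (j0 : J)
    (t : I -> J -> R) (p : I -> S -> R) (phi : S -> R -> R) :
  (forall i s, 0 <= p i s) -> (forall i, \sum_s p i s = 1) ->
  (forall s x y, phi s x - phi s y <= `|x - y|) ->
  expect p (fun f => fmax j0
    (fun j => \sum_i (\sum_r p i r * phi r (t i j) - phi (f i) (t i j))))
  <= expect (fun _ _ => 2^-1) (fun e : {ffun I -> bool} => fmax j0
    (fun j => \sum_i 2 * (-1) ^+ (e i) * t i j)).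
Proof.
move=> p0 p1 lip.
have u0 (i : I) (b : bool) : 0 <= 2^-1 :> R by rewrite invr_ge0.
have u1 (i : I) := sum_bool_half R.
pose X (r : seq I) (e : {ffun I -> bool}) (f : {ffun I -> S}) i j :=
  if i \in r then 2 * (-1) ^+ (e i) * t i j
  else \sum_r p i r * phi r (t i j) - phi (f i) (t i j).
pose V r := expect (fun _ _ => 2^-1) (fun e => expect p (fun f =>
  fmax j0 (fun j => \sum_i X r e f i j))).
have V0 : V [::] = expect p (fun f => fmax j0
    (fun j => \sum_i (\sum_r p i r * phi r (t i j) - phi (f i) (t i j)))).
  by rewrite -[RHS](expect_cst _ u1).
have Venum : V (enum I) = expect (fun _ _ => 2^-1)
      (fun e : {ffun I -> bool} => fmax j0
    (fun j => \sum_i 2 * (-1) ^+ (e i) * t i j)).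
  apply: eq_expect => e; rewrite -[RHS](expect_cst _ p1).
  apply: eq_expect => f; congr (fmax _ _); apply/funext => j.
  by apply: eq_bigr => i _; rewrite /X mem_enum.
rewrite -V0 -Venum.
have : uniq (enum I) by exact: enum_uniq.
elim: (enum I) => [|i r IH] //= /andP[ir /IH]; move/le_trans; apply.
(* Resampling coordinate [i] of [e] on the right and of [f] on the left isolates the term of index
   [i]. The other terms, gathered in [h], do not depend on that coordinate, so the one-coordinate
   inequality applies. *)
rewrite {2}/V (expect_resample i _ u1).
apply: expect_le => // e.
rewrite (expect_resample i _ p1).
under [leRHS]eq_bigr => b _ do rewrite -expectZ.
rewrite -expect_sum; apply: expect_le => // f.
pose h j := \sum_(l | l != i) X r e f l j.
have -> : \sum_s p i s * fmax j0 (fun j => \sum_l X r e (upd f i s) l j) =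
  \sum_s p i s * fmax j0 (fun j =>
    h j + (\sum_r p i r * phi r (t i j) - phi s (t i j))).
  apply: eq_bigr => s _; congr (_ * fmax _ _); apply/funext => j.
  rewrite (bigD1 i) //= addrC {2}/X (negPf ir) ffunE eqxx; congr (_ + _).
  by apply: eq_bigr => l /negPf li; rewrite /X ffunE li.
have -> : \sum_(b : bool) 2^-1 * fmax j0
      (fun j => \sum_l X (i :: r) (upd e i b) f l j) =
    \sum_(b : bool) 2^-1 * fmax j0 (fun j => h j + 2 * (-1) ^+ b * t i j).
  apply: eq_bigr => s _; congr (_ * fmax _ _); apply/funext => j.
  rewrite (bigD1 i) //= addrC {2}/X mem_head ffunE eqxx; congr (_ + _).
  by apply: eq_bigr => l /negPf li; rewrite /X inE ffunE li.
exact: contraction1.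
Qed.

(** Once the square is expanded, averaging over the sign of index [i] kills each off-diagonal
    product, and on the diagonal the signs square to 1. *)
Lemma expect_rademacher_sqr (R : realFieldType) (I : finType) (x : I -> R) :
  expect (fun _ _ => 2^-1)
    (fun e : {ffun I -> bool} => (\sum_i (-1) ^+ (e i) * x i) ^+ 2)
  = \sum_i x i ^+ 2.
Proof.
have u1 (i : I) := sum_bool_half R.
under eq_expect => e.
  rewrite expr2 big_distrlr /=.
  over.
rewrite expect_sum; apply: eq_bigr => i _.
rewrite expect_sum (bigD1 i) //= big1 ?addr0 => [|l li].
  rewrite -[RHS](expect_cst _ u1); apply: eq_expect => e.
  by rewrite mulrACA -expr2 sqrr_sign mul1r expr2.
rewrite (expect_resample i _ u1) -[RHS](expect_cst _ u1).
apply: eq_expect => e; rewrite big_bool !ffunE eqxx (negPf li) /=.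
by rewrite !expr1 !expr0; ring.
Qed.

(** * Cauchy-Schwarz inequality and the Euclidean norm *)

(** Cauchy-Schwarz by Lagrange's identity, with bounds [a] and [b] in place of the two norms. *)
Lemma sum_mul_le (R : realFieldType) (I : finType) (x y : I -> R) (a b : R) :
  0 <= a -> 0 <= b -> \sum_i x i ^+ 2 <= a ^+ 2 -> \sum_i y i ^+ 2 <= b ^+ 2 ->
  \sum_i x i * y i <= a * b.
Proof.
move=> a0 b0 xa yb; apply: le_trans (ler_norm _) _.
rewrite -[leRHS]ger0_norm ?mulr_ge0 // -ler_sqr ?nnegrE //.
rewrite !real_normK ?num_real // exprMn.
apply: (@le_trans _ _ ((\sum_i x i ^+ 2) * (\sum_i y i ^+ 2))); last first.
  by apply: ler_pM => //; apply: sumr_ge0 => i _; exact: sqr_ge0.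
have : 0 <= \sum_i \sum_j (x i * y j - x j * y i) ^+ 2.
  by apply: sumr_ge0 => i _; apply: sumr_ge0 => j _; exact: sqr_ge0.
have -> : \sum_i \sum_j (x i * y j - x j * y i) ^+ 2 =
    \sum_i \sum_j (x i ^+ 2 * y j ^+ 2) + \sum_i \sum_j (y i ^+ 2 * x j ^+ 2)
    - 2 * \sum_i \sum_j (x i * y i * (x j * y j)).
  rewrite mulr_sumr -sumrN -!big_split; apply: eq_bigr => i _ /=.
  rewrite mulr_sumr -sumrN -!big_split; apply: eq_bigr => j _ /=.
  by ring.
rewrite -!big_distrlr /= -expr2.
set X := \sum_i x i ^+ 2; set Y := \sum_i y i ^+ 2.
by rewrite (mulrC Y) => ?; lra.
Qed.

Lemma l2norm_ge0 (R : realType) (n : nat) (v : 'cV[R]_n) : 0 <= l2norm v.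
Proof. exact: sqrtr_ge0. Qed.

Lemma sqr_l2norm (R : realType) (n : nat) (v : 'cV[R]_n) :
  l2norm v ^+ 2 = \sum_i v i 0 ^+ 2.
Proof. by rewrite sqr_sqrtr // sumr_ge0 // => i _; exact: sqr_ge0. Qed.

Lemma l2normZ (R : realType) (n : nat) (a : R) (v : 'cV[R]_n) :
  0 <= a -> l2norm (a *: v) = a * l2norm v.
Proof.
move=> a0; rewrite /l2norm.
under eq_bigr => i _ do rewrite mxE exprMn.
by rewrite -mulr_sumr sqrtrM ?sqr_ge0 // sqrtr_sqr ger0_norm.
Qed.

Lemma l2norm_eq0 (R : realType) (n : nat) (v : 'cV[R]_n) :
  (l2norm v == 0) = (v == 0).
Proof.
rewrite -sqrf_eq0 sqr_l2norm psumr_eq0 => [|i _]; last exact: sqr_ge0.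
apply/allP/eqP => [v0|-> i _]; last by rewrite mxE expr0n eqxx.
apply/matrixP => i j; rewrite (ord1 j) mxE; apply/eqP.
by rewrite -sqrf_eq0; exact: (v0 i (mem_index_enum i)).
Qed.

Lemma l2norm0 (R : realType) (n : nat) : l2norm (0 : 'cV[R]_n) = 0.
Proof. by apply/eqP; rewrite l2norm_eq0. Qed.

Lemma normalize_unit_sphere (R : realType) (n : nat) (v : 'cV[R]_n) :
  v != 0 -> unit_sphere R n ((l2norm v)^-1 *: v).
Proof.
rewrite -l2norm_eq0 => v0; rewrite /unit_sphere /=.
by rewrite l2normZ ?invr_ge0 ?l2norm_ge0 // mulVf.
Qed.

(** * One-sided slopes of the l1 objective *)

(** The three signs are encoded in a finite type, so that sums over noise patterns are finite. *)
Definition sign_pattern (R : realType) (x : R) : option bool :=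
  if x == 0 then None else Some (0 < x).

(* One-sided derivative at 0 of [h |-> `|z - h * x|], where [s] is the sign
   pattern of [z]. *)
Definition abs_slope (R : realType) (s : option bool) (x : R) : R :=
  match s with None => `|x| | Some true => - x | Some false => x end.

Lemma abs_slope_lip (R : realType) (s : option bool) (x y : R) :
  abs_slope s x - abs_slope s y <= `|x - y|.
Proof.
case: s => [[]|] /=; last exact: lerB_dist.
  by rewrite distrC opprK addrC ler_norm.
exact: ler_norm.
Qed.

Lemma abs_slopeZ (R : realType) (s : option bool) (a x : R) :
  0 <= a -> abs_slope s (a * x) = a * abs_slope s x.
Proof.
by move=> a0; case: s => [[]|] /=; rewrite ?mulrN // normrM (ger0_norm a0).
Qed.

(** Convexity of h |-> |z - h x|: its value at 1 is at least its value at 0 plus the one-sided slope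
    at 0. *)
Lemma abs_slope_le (R : realType) (z x : R) :
  `|z| + abs_slope (sign_pattern z) x <= `|z - x|.
Proof.
rewrite /sign_pattern; have [->|z0] := eqVneq z 0.
  by rewrite normr0 add0r sub0r normrN.
have [zp|zn] /= := ltrP 0 z.
  by rewrite (gtr0_norm zp) ler_norm.
by rewrite (ler0_norm zn) distrC addrC ler_norm.
Qed.

(** The amount by which the slope of the l1 objective at the true parameter in direction [v], for
    noise signs [f], falls below its mean under [p]. *)
Definition slope_dev (R : realType) (m k : nat) (p : 'I_m -> option bool -> R)
    (f : {ffun 'I_m -> option bool}) (A : 'M[R]_(m, k)) (v : 'cV[R]_k) : R :=
  \sum_i (\sum_s p i s * abs_slope s ((A *m v) i 0)
          - abs_slope (f i) ((A *m v) i 0)).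

Lemma slope_devZ (R : realType) (m k : nat) (p : 'I_m -> option bool -> R)
    (f : {ffun 'I_m -> option bool}) (A : 'M[R]_(m, k)) (a : R) (v : 'cV[R]_k) :
  0 <= a -> slope_dev p f A (a *: v) = a * slope_dev p f A v.
Proof.
move=> a0; rewrite mulr_sumr; apply: eq_bigr => i _.
rewrite -scalemxAr mxE abs_slopeZ // mulrBr mulr_sumr; congr (_ - _).
by apply: eq_bigr => s _; rewrite abs_slopeZ // mulrCA.
Qed.

Lemma slope_dev0 (R : realType) (m k : nat) (p : 'I_m -> option bool -> R)
    (f : {ffun 'I_m -> option bool}) (A : 'M[R]_(m, k)) :
  slope_dev p f A 0 = 0.
Proof. by have := slope_devZ p f A 0 (lexx 0); rewrite scale0r mul0r. Qed.

(** * Fluctuation of the slope over all directions, for a fixed matrix *)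

(** Contraction leaves 2 <v(e), W j>, where v(e) is the signed sum of the rows of [A]. The mean of
    |v(e)|^2 is the squared Frobenius norm, at most [B ^+ 2]. *)
Lemma expect_max_slope_dev (R : realType) (m k : nat) (J : finType) (j0 : J)
    (p : 'I_m -> option bool -> R) (A : 'M[R]_(m, k)) (W : J -> 'cV[R]_k)
    (B : R) :
  (forall i s, 0 <= p i s) -> (forall i, \sum_s p i s = 1) ->
  (forall j, l2norm (W j) <= 1) -> 0 < B ->
  \sum_i \sum_j A i j ^+ 2 <= B ^+ 2 ->
  expect p (fun f => fmax j0 (fun j => slope_dev p f A (W j))) <= 2 * B.
Proof.
move=> p0 p1 W1 B0 AB.
have u0 (i : 'I_m) (b : bool) : 0 <= 2^-1 :> R by rewrite invr_ge0.
have u1 (i : 'I_m) := sum_bool_half R.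
apply: le_trans (contraction j0 (fun i j => (A *m W j) i 0) p0 p1
  (@abs_slope_lip R)) _.
pose v (e : {ffun 'I_m -> bool}) (l : 'I_k) := \sum_i (-1) ^+ (e i) * A i l.
apply: (@le_trans _ _ (expect (fun _ _ => 2^-1)
    (fun e : {ffun 'I_m -> bool} => B^-1 * (\sum_l v e l ^+ 2) + B))).
  apply: expect_le => // e; apply: fmax_le => j.
  have -> : \sum_i 2 * (-1) ^+ e i * (A *m W j) i 0 =
      \sum_l 2 * (v e l * W j l 0).
    under eq_bigr => i _ do rewrite mxE mulr_sumr.
    rewrite exchange_big /=; apply: eq_bigr => l _.
    rewrite mulr_suml mulr_sumr; apply: eq_bigr => i _; ring.
  (* Young's inequality with weight [B], chosen so that each of the two terms contributes at most
     [B] in the mean. *)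
  apply: (@le_trans _ _ (\sum_l (B^-1 * v e l ^+ 2 + B * W j l 0 ^+ 2))).
    apply: ler_sum => l _; rewrite -subr_ge0.
    have -> : B^-1 * v e l ^+ 2 + B * W j l 0 ^+ 2 - 2 * (v e l * W j l 0) =
      B^-1 * (v e l - B * W j l 0) ^+ 2 by field; rewrite gt_eqF.
    by rewrite mulr_ge0 ?sqr_ge0 // invr_ge0 ltW.
  rewrite big_split /= -!mulr_sumr lerD2l -sqr_l2norm.
  rewrite -[leRHS]mulr1; apply: ler_wpM2l; first exact: ltW.
  by rewrite expr_le1 ?l2norm_ge0.
rewrite expectD expectZ expect_sum (expect_cst _ u1).
under eq_bigr => l _ do rewrite expect_rademacher_sqr.
rewrite exchange_big /= mulr_natl mulr2n lerD2r.
by rewrite mulrC ler_pdivrMr // -expr2.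
Qed.

(** Markov's inequality. Each bad pattern receives a normalized violating direction and every other
    pattern the direction 0, so a family indexed by the finitely many patterns replaces the supremum
    over the ball. *)
Lemma slope_dev_tail (R : realType) (m k : nat) (p : 'I_m -> option bool -> R)
    (A : 'M[R]_(m, k)) (B t : R) (bad : pred {ffun 'I_m -> option bool}) :
  (forall i s, 0 <= p i s) -> (forall i, \sum_s p i s = 1) ->
  0 < B -> \sum_i \sum_j A i j ^+ 2 <= B ^+ 2 -> 0 < t ->
  (forall f, bad f -> exists v, t * l2norm v < slope_dev p f A v) ->
  \sum_(f | bad f) \prod_i p i (f i) <= 2 * B / t.
Proof.
move=> p0 p1 B0 AB t0 badP.
have unit f : exists v : 'cV[R]_k, l2norm v <= 1 /\
    (if bad f then t else 0) <= slope_dev p f A v.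
  case: ifPn => [/badP[v tv]|_]; last first.
    by exists 0; rewrite l2norm0 slope_dev0 ler01.
  have v0 : 0 < l2norm v.
    rewrite lt_def l2norm_ge0 l2norm_eq0 andbT; apply/eqP => v0.
    by move: tv; rewrite v0 l2norm0 slope_dev0 mulr0 ltxx.
  exists ((l2norm v)^-1 *: v).
  have v1 : 0 <= (l2norm v)^-1 by rewrite invr_ge0 ltW.
  rewrite l2normZ // slope_devZ // mulVf ?gt_eqF //; split => //.
  by rewrite ler_pdivlMl // mulrC ltW.
have [W WP] := choice unit.
rewrite ler_pdivlMr //.
apply: le_trans (expect_max_slope_dev [ffun=> None] p0 p1
  (fun f => (WP f).1) B0 AB).
rewrite big_mkcond mulr_suml; apply: ler_sum => f _.
apply: (@le_trans _ _ ((\prod_i p i (f i)) * (if bad f then t else 0))).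
  by case: ifP => _; rewrite ?mulr0 ?mul0r.
apply: ler_wpM2l; first exact: prodr_ge0.
exact: le_trans (WP f).2 (fmax_ge _ (fun g => slope_dev p f A (W g)) f).
Qed.

(** * Deterministic recovery criterion *)

(** If [u] differed from [ustar], convexity and minimality would make the total slope in direction
    [u - ustar] nonpositive, and by homogeneity also in the normalized direction. *)
Lemma l1_recovery (R : realType) (m k : nat) (A : 'M[R]_(m, k)) (z : 'cV[R]_m)
    (ustar u : 'cV[R]_k) :
  argmin (fun v : 'cV[R]_k => l1norm (A *m ustar + z - A *m v)) u ->
  (forall D, unit_sphere R k D ->
    0 < \sum_i abs_slope (sign_pattern (z i 0)) ((A *m D) i 0)) ->
  u = ustar.
Proof.
move=> /(_ ustar) minu pos; apply/eqP; rewrite -subr_eq0; apply/negPn/negP.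
set v := u - ustar => v0.
have := pos _ (normalize_unit_sphere v0); rewrite ltNge => /negP; apply.
under eq_bigr => i _ do rewrite -scalemxAr mxE abs_slopeZ ?invr_ge0 ?l2norm_ge0 //.
rewrite -mulr_sumr mulr_ge0_le0 ?invr_ge0 ?l2norm_ge0 //.
have : \sum_i (`|z i 0| + abs_slope (sign_pattern (z i 0)) ((A *m v) i 0)) <=
    \sum_i `|z i 0|.
  apply: (@le_trans _ _ (l1norm (A *m ustar + z - A *m u))).
    apply: ler_sum => i _; apply: le_trans (abs_slope_le _ _) _.
    rewrite mulmxBr !mxE le_eqVlt; apply/orP; left; apply/eqP; congr `|_|.
    by ring.
  by apply: le_trans minu _; rewrite addrAC subrr add0r.
by rewrite big_split /= gerDl.
Qed.

(** The mean slope of row [i] at x is [p i None] |x| - [eps] [a i] x. The lower bound [lam] controls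
    the first part, the bound on the weighted mean of the rows the second, and [t] the deviation
    from the mean. *)
Lemma sum_slope_gt0 (R : realType) (m k : nat) (p : 'I_m -> option bool -> R)
    (f : {ffun 'I_m -> option bool}) (A : 'M[R]_(m, k)) (D : 'cV[R]_k)
    (eps s t lam : R) (a : 'I_m -> R) :
  (0 < m)%N -> unit_sphere R k D -> 0 <= eps -> eps <= 1 -> 0 <= s ->
  (forall i, 1 - eps <= p i None) ->
  (forall i, p i (Some true) - p i (Some false) = eps * a i) ->
  l2norm (m%:R^-1 *: \sum_(i < m) a i *: (row i A)^T) ^+ 2 <= s ^+ 2 ->
  lam <= m%:R^-1 * \sum_(i < m) `|(row i A *m D) 0 0| ->
  slope_dev p f A D <= t ->
  m%:R^-1 * t < (1 - eps) * lam - eps * s ->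
  0 < \sum_i abs_slope (f i) ((A *m D) i 0).
Proof.
move=> m0 D1 eps0 eps1 s0 pN pS las lamD devt tlt.
have mi0 : 0 < (m%:R : R)^-1 by rewrite invr_gt0 ltr0n.
rewrite -(pmulr_rgt0 _ mi0).
have rowE i : (row i A *m D) 0 0 = (A *m D) i 0 by rewrite -row_mul mxE.
have slopeE i x : \sum_s0 p i s0 * abs_slope s0 x =
    p i None * `|x| - eps * (a i * x).
  rewrite (bigID (pred1 None)) /= big_pred1_eq; congr (_ + _).
  rewrite (bigD1 (Some true)) //= (bigD1 (Some false)) //= big1 ?addr0.
    by rewrite mulrA -pS; ring.
  by case=> [[]|].
(* Cauchy-Schwarz between the unit vector [D] and the weighted mean of the rows. *)
have lin : m%:R^-1 * \sum_i a i * (A *m D) i 0 <= s.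
  set v := _ *: _ in las.
  have -> : m%:R^-1 * \sum_i a i * (A *m D) i 0 = \sum_l v l 0 * D l 0.
    rewrite mulr_sumr.
    under eq_bigr => i _ do rewrite mxE mulrA mulr_sumr.
    rewrite exchange_big /=; apply: eq_bigr => l _.
    rewrite /v mxE summxE mulr_sumr mulr_suml; apply: eq_bigr => i _.
    by rewrite !mxE; ring.
  rewrite -[leRHS]mulr1; apply: sum_mul_le => //.
    by rewrite -sqr_l2norm.
  by rewrite -sqr_l2norm D1 expr1n.
have : m%:R^-1 * slope_dev p f A D <= m%:R^-1 * t.
  by apply: ler_wpM2l => //; exact: ltW.
rewrite /slope_dev; under eq_bigr => i _ do rewrite slopeE.
rewrite !sumrB /= -mulr_sumr.
have : m%:R^-1 * ((1 - eps) * \sum_i `|(A *m D) i 0|) <=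
    m%:R^-1 * \sum_i p i None * `|(A *m D) i 0|.
  apply: ler_wpM2l; first exact: ltW.
  rewrite mulr_sumr; apply: ler_sum => i _.
  exact: ler_wpM2r.
have : (1 - eps) * lam <= (1 - eps) * (m%:R^-1 * \sum_i `|(A *m D) i 0|).
  rewrite ler_wpM2l ?subr_ge0 //.
  by move: lamD; under eq_bigr => i _ do rewrite rowE.
have := ler_wpM2l eps0 lin.
move: tlt; set X := \sum_i p i None * _; set Y := \sum_i abs_slope _ _.
set Z := \sum_i `|_|; set W := \sum_i _ * _.
rewrite !mulrDr !mulrN (mulrCA _ eps W) (mulrCA _ _ Z).
lra.
Qed.

(** * Continuity in the direction and reduction to rational directions *)

Lemma cvg_sum (R : realType) (T : Type) (F : set_system T) (FF : Filter F)
    (I : Type) (r : seq I) (f : I -> T -> R) (a : I -> R) :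
  (forall i, f i x @[x --> F] --> a i) ->
  \sum_(i <- r) f i x @[x --> F] --> \sum_(i <- r) a i.
Proof.
move=> fa; apply: (@cvg_big R^o _ _ _ _ (@add_continuous R^o)) => i _.
exact: fa.
Qed.

Section slope_dev_continuity.
Context (R : realType) (T : Type) (F : set_system T) (FF : Filter F).
Context (m k : nat) (p : 'I_m -> option bool -> R).
Context (f : {ffun 'I_m -> option bool}) (A : 'M[R]_(m, k)).
Context (g : T -> 'cV[R]_k) (v : 'cV[R]_k).
Context (gv : forall l, g x l 0 @[x --> F] --> v l 0).

Let cvg_slope s i :
  abs_slope s ((A *m g x) i 0) @[x --> F] --> abs_slope s ((A *m v) i 0).
Proof.
have cvgA : (A *m g x) i 0 @[x --> F] --> (A *m v) i 0.
  under eq_fun do rewrite mxE.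
  rewrite mxE; apply: cvg_sum => l.
  by apply: cvgM; [exact: cvg_cst|exact: gv].
case: s => [[]|] /=; [exact: cvgN|exact: cvgA|].
exact: cvg_norm.
Qed.

Lemma cvg_slope_dev : slope_dev p f A (g x) @[x --> F] --> slope_dev p f A v.
Proof.
apply: cvg_sum => i; apply: cvgB; last exact: cvg_slope.
by apply: cvg_sum => s; apply: cvgM; [exact: cvg_cst|exact: cvg_slope].
Qed.

Lemma cvg_l2norm : l2norm (g x) @[x --> F] --> l2norm v.
Proof.
apply: (@cvg_comp _ _ _ _ (@Num.sqrt R)); last exact: sqrt_continuous.
apply: cvg_sum => i; rewrite expr2; under eq_fun do rewrite expr2.
by apply: cvgM; exact: gv.
Qed.

End slope_dev_continuity.

(** Both sides are continuous and rational vectors are dense. This turns the existence of a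
    violating direction into a countable union, hence a measurable event. *)
Lemma slope_dev_dense (R : realType) (m k : nat) (p : 'I_m -> option bool -> R)
    (f : {ffun 'I_m -> option bool}) (A : 'M[R]_(m, k)) (t : R) (v : 'cV[R]_k) :
  (forall q : 'cV[rat]_k, slope_dev p f A (map_mx ratr q) <=
    t * l2norm (map_mx ratr q : 'cV[R]_k)) ->
  slope_dev p f A v <= t * l2norm v.
Proof.
move=> dense; rewrite leNgt; apply/negP => tv.
have op : nbhs v [set x | 0 < slope_dev p f A x - t * l2norm x].
  have vv l : (x : 'cV[R]_k) l 0 @[x --> nbhs v] --> v l 0.
    exact: coord_continuous.
  have cts : slope_dev p f A x - t * l2norm x @[x --> nbhs v] -->
      slope_dev p f A v - t * l2norm v.
    apply: cvgB; first exact: cvg_slope_dev.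
    by apply: cvgM; [exact: cvg_cst|exact: cvg_l2norm].
  by apply: (cvgr_gt _ cts); rewrite subr_gt0.
have /nbhs_ballP[e /= e0 ve] := op.
have qP l : exists q : rat, `|v l 0 - ratr q| < e.
  have /rat_in_itvoo[q /itvP qe] : v l 0 - e < v l 0 + e by lra.
  by exists q; rewrite distrC ltr_distl !qe.
have [q qe] := choice qP.
have : 0 < slope_dev p f A (map_mx ratr (\col_l q l)) -
    t * l2norm (map_mx ratr (\col_l q l) : 'cV[R]_k).
  by apply: ve; split => // i j; rewrite !mxE (ord1 j); exact: qe.
by rewrite subr_gt0 ltNge dense.
Qed.

(** * Consequences of condition (B) for a fixed matrix *)

(** The basis vectors are unit directions, so each of the [k] columns has squared norm at most
    [m%:R * lam2]. *)
Lemma frobenius_le (R : realType) (m k : nat) (A : 'M[R]_(m, k)) (lam2 : R) :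
  (0 < m)%N ->
  (ereal_sup [set (m%:R^-1 *
                   \sum_(i < m) `|(row i A *m D) 0 0| ^+ 2)%R%:E
             | D in unit_sphere R k] <= lam2%:E)%E ->
  \sum_i \sum_j A i j ^+ 2 <= m%:R * k%:R * lam2.
Proof.
move=> m0 supA; rewrite exchange_big /= -mulrA mulrCA mulr_natl.
rewrite -[k in leRHS]card_ord -sumr_const; apply: ler_sum => j _.
rewrite -ler_pdivrMl ?ltr0n // -lee_fin; apply: le_trans supA.
apply: ereal_sup_ubound => /=; exists (delta_mx j 0).
  rewrite /unit_sphere /l2norm /= (bigD1 j) //= big1 ?addr0.
    by rewrite !mxE !eqxx expr1n sqrtr1.
  by move=> i /negPf ij; rewrite !mxE ij expr0n.
congr (_ * _)%:E; apply: eq_bigr => i _.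
by rewrite -colE !mxE real_normK // num_real.
Qed.

(** With fewer rows than columns the matrix has a nonzero kernel vector; once normalized, it makes
    the infimum at most 0. *)
Lemma underdetermined_lam_le0 (R : realType) (m k : nat) (A : 'M[R]_(m, k))
    (lam : R) :
  (m < k)%N ->
  (lam%:E <= ereal_inf [set (m%:R^-1 *
                   \sum_(i < m) `|(row i A *m D) 0 0|)%R%:E
             | D in unit_sphere R k])%E ->
  lam <= 0.
Proof.
move=> mk lamA.
have : kermx A^T != 0.
  rewrite kermx_eq0 /row_free; apply/negP => /eqP r.
  by have := rank_leq_col A^T; rewrite r leqNgt mk.
move=> /rowV0Pn[v /sub_kermxP vA v0].
have vT0 : v^T != 0 by rewrite -(inj_eq (@trmx_inj _ _ _)) trmxK trmx0.
rewrite -lee_fin; apply: (le_trans lamA); apply: ereal_inf_lbound => /=.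
exists ((l2norm v^T)^-1 *: v^T); first exact: normalize_unit_sphere.
rewrite big1 ?mulr0 // => i _.
rewrite -scalemxAr -row_mul -[A]trmxK -trmx_mul vA.
by rewrite !mxE mulr0 normr0.
Qed.

(** * Measurability of the bad matrices and of the sign patterns *)

Lemma sigma_mx_entry (d : measure_display) (T : measurableType d)
    (R : realType) (m n : nat) (X : T -> 'M[R]_(m, n)) (i : 'I_m) (j : 'I_n) :
  measurable_fun [set: g_sigma_algebraType
    (\bigcup_(ij in [set: 'I_m * 'I_n]) g_sigma_algebra_preimage
        (fun w => X w ij.1 ij.2 : measurableTypeR R))]
    (fun w => X w i j : measurableTypeR R).
Proof.
move=> _ Y mY; rewrite setTI; apply: sub_sigma_algebra; exists (i, j) => //.
by exists Y => //; rewrite setTI.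
Qed.

Lemma sigma_mx_measurable (d : measure_display) (T : measurableType d)
    (R : realType) (m n : nat) (X : T -> 'M[R]_(m, n)) (E : set T) :
  random_mx X -> sigma_mx X E -> measurable E.
Proof.
move=> mX; apply: smallest_sub; first exact: sigma_algebra_measurable.
move=> _ [[i j] _ [B mB <-]]; exact: mX.
Qed.

Lemma measurable_fun_abs_slope (d : measure_display) (T : measurableType d)
    (R : realType) (s : option bool) (h : T -> R) :
  measurable_fun [set: T] h ->
  measurable_fun [set: T] (fun w => abs_slope s (h w)).
Proof.
move=> mh; case: s => [[]|] /=; [exact: measurable_funN|exact: mh|].
exact: (measurableT_comp (@normr_measurable R setT)).
Qed.

Section bad_matrix.
Context (R : realType) (m k : nat) (p : 'I_m -> option bool -> R) (B t : R).
Context (f : {ffun 'I_m -> option bool}).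

(** For a fixed pattern [f] this condition concerns the matrix alone, so its event is independent of
    the noise having pattern [f]. The Frobenius bound is included so that the tail bound covers
    every matrix of the set. *)
Definition bad_matrix : set 'M[R]_(m, k) :=
  [set A : 'M[R]_(m, k) | \sum_i \sum_j A i j ^+ 2 <= B ^+ 2 /\
    exists v, t * l2norm v < slope_dev p f A v].

Lemma bad_matrixE : bad_matrix =
  \bigcup_(q : 'cV[rat]_k) ([set A : 'M[R]_(m, k) | \sum_i \sum_j A i j ^+ 2 <= B ^+ 2] `&`
    ~` [set A : 'M[R]_(m, k) | slope_dev p f A (map_mx ratr q) <=
      t * l2norm (map_mx ratr q : 'cV[R]_k)]).
Proof.
apply/seteqP; split=> A.
  move=> [AB [v tv]]; apply: contrapT => nq.
  suff : slope_dev p f A v <= t * l2norm v by rewrite leNgt tv.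
  apply: slope_dev_dense => q; apply: contrapT => qA.
  by apply: nq; exists q.
by move=> [q _ [AB /negP qA]]; split=> //; exists (map_mx ratr q); rewrite ltNge.
Qed.

Lemma sigma_mx_bad_matrix (d : measure_display) (T : measurableType d)
    (A : T -> 'M[R]_(m, k)) : sigma_mx A (A @^-1` bad_matrix).
Proof.
set G := \bigcup_(ij in [set: 'I_m * 'I_k]) g_sigma_algebra_preimage
  (fun w => A w ij.1 ij.2 : measurableTypeR R).
have mA i j : measurable_fun [set: g_sigma_algebraType G] (fun w => A w i j).
  exact: sigma_mx_entry.
have mS q s i : measurable_fun [set: g_sigma_algebraType G]
    (fun w => abs_slope s ((A w *m q) i 0)).
  apply: measurable_fun_abs_slope; under eq_fun do rewrite mxE.
  apply: measurable_sum => l; apply: measurable_funM => //.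
have mF : measurable_fun [set: g_sigma_algebraType G]
    (fun w => \sum_i \sum_j A w i j ^+ 2).
  by apply: measurable_sum => i; apply: measurable_sum => j;
    exact: measurable_funX.
have mD q : measurable_fun [set: g_sigma_algebraType G]
    (fun w => slope_dev p f (A w) q).
  apply: measurable_sum => i; apply: measurable_funB => //.
  by apply: measurable_sum => s; exact: measurable_funM.
rewrite bad_matrixE preimage_bigcup.
change (G.-sigma.-measurable (\bigcup_(q : 'cV[rat]_k) (A @^-1`
  ([set A : 'M[R]_(m, k) | \sum_i \sum_j A i j ^+ 2 <= B ^+ 2] `&`
    ~` [set A : 'M[R]_(m, k) | slope_dev p f A (map_mx ratr q) <=
      t * l2norm (map_mx ratr q : 'cV[R]_k)])))).
apply: countable_bigcupT_measurable => [|q]; first exact: countableP.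
rewrite preimage_setI; apply: measurableI.
  have := measurable_fun_le measurableT mF
    (@measurable_cst _ _ _ _ setT (B ^+ 2)).
  by rewrite setTI.
rewrite preimage_setC; apply: measurableC.
have := measurable_fun_le measurableT (mD (map_mx ratr q))
  (@measurable_cst _ _ _ _ setT (t * l2norm (map_mx ratr q : 'cV[R]_k))).
by rewrite setTI.
Qed.

End bad_matrix.

Lemma measurable_sign_pattern (R : realType) (s : option bool) :
  measurable ((@sign_pattern R) @^-1` [set s] : set (measurableTypeR R)).
Proof.
have -> : (@sign_pattern R) @^-1` [set s] =
  match s with
  | None => [set 0]
  | Some true => `]0, +oo[%classic
  | Some false => `]-oo, 0[%classic
  end.
  apply/seteqP; rewrite /sign_pattern; split => x /=.
    case: eqVneq => [->|x0 <-] //; first by move=> <-.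
    by have [x1|x1] /= := ltrP 0 x; rewrite in_itv /= ?andbT // lt_neqAle x0.
  case: s => [[]|] /=; rewrite ?in_itv /= ?andbT; last by move=> ->; rewrite eqxx.
    by move=> x0; rewrite gt_eqF // x0.
  by move=> x0; rewrite lt_eqF // ltNge ltW.
by case: s => [[]|].
Qed.

(** * Probabilities of finite unions and intersections *)

Section finite_union.
Context (d : measure_display) (T : measurableType d) (R : realType).
Context (P : probability T R) (I : finType).

Lemma probability_fibers (Y : T -> I) :
  (forall s, measurable (Y @^-1` [set s])) ->
  \sum_s fine (P (Y @^-1` [set s])) = 1.
Proof.
move=> mY; apply: EFin_inj; rewrite -sumEFin.
under eq_bigr => s _ do rewrite fineK ?fin_num_measure //.
rewrite (fsbig_seq _ _ (index_enum_uniq I)) -measure_fin_bigcup //.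
- rewrite -[RHS](probability_setT P); congr (P _); apply/seteqP; split=> // x _.
  by exists (Y x) => //=; rewrite mem_index_enum.
- by move=> s r _ _ [x [<- <-]].
Qed.

(** Conditioning in finite form: by the union bound and independence, the probability is at most the
    sum of P (D s) [p s], which is the integral over x of the sum of [p s] over the [s] with x in
    [D s]; the integrand is at most [theta] pointwise. *)
Lemma probability_mixture_le (D E : I -> set T) (p : I -> R) (theta : R) :
  (forall s, measurable (D s)) -> (forall s, measurable (E s)) ->
  (forall s, P (D s `&` E s) = (P (D s) * P (E s))%E) ->
  (forall s, P (E s) = (p s)%:E) -> (forall s, 0 <= p s) ->
  (forall x, \sum_(s | x \in D s) p s <= theta) ->
  (P (\bigcup_s (D s `&` E s)) <= theta%:E)%E.
Proof.
move=> mD mE DE Ep p0 ptheta.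
have mDE s : measurable (D s `&` E s) by exact: measurableI.
have le1 : (P (\bigcup_s (D s `&` E s)) <= \sum_s P (D s `&` E s))%E.
  rewrite (fsbig_seq _ _ (index_enum_uniq I)).
  apply: content_sub_fsum => //.
    by apply: fin_bigcup_measurable.
  by move=> x [s _ DEx]; exists s => //=; rewrite mem_index_enum.
apply: (le_trans le1).
have -> : (\sum_s P (D s `&` E s) =
    \int[P]_x \sum_s (p s)%:E * (\1_(D s) x)%:E)%E.
  rewrite ge0_integral_sum //.
  - apply: eq_bigr => s _; rewrite DE Ep muleC.
    rewrite ge0_integralZl_EFin //; first by rewrite integral_indic // setIT.
    by apply/measurable_EFinP; exact: measurable_indic.
  - move=> s; apply: emeasurable_funM => //.
    by apply/measurable_EFinP; exact: measurable_indic.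
  - by move=> s x _; rewrite -EFinM lee_fin mulr_ge0 // indicE.
apply: (@le_trans _ _ (\int[P]_x (cst theta%:E) x)%E); last first.
  by rewrite integral_cst // [X in (_ * X)%E]probability_setT mule1.
apply: ge0_le_integral => //.
- move=> x _; apply: sume_ge0 => s _.
  by rewrite -EFinM lee_fin mulr_ge0 // indicE.
- apply: emeasurable_sum => s; apply: emeasurable_funM => //.
  by apply/measurable_EFinP; exact: measurable_indic.
- move=> x _ /=; under eq_bigr => s _ do rewrite -EFinM.
  rewrite sumEFin lee_fin; apply: le_trans (ptheta x).
  rewrite [leRHS]big_mkcond; apply: ler_sum => s _.
  by rewrite indicE; case: (x \in D s); rewrite ?mulr1 ?mulr0.
Qed.

End finite_union.

Lemma probability_setI_ge (d : measure_display) (T : measurableType d)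
    (R : realType) (P : probability T R) (A B : set T) (a b : R) :
  measurable A -> measurable B ->
  ((1 - a)%:E <= P A)%E -> ((1 - b)%:E <= P B)%E ->
  ((1 - (a + b))%:E <= P (A `&` B))%E.
Proof.
move=> mA mB.
have mAB : measurable (A `&` B) by exact: measurableI.
have : (P (~` A `|` ~` B) <= P (~` A) + P (~` B))%E.
  by apply: measureU2; exact: measurableC.
rewrite -setCI !probability_setC //.
rewrite -[P A]fineK ?fin_num_measure // -[P B]fineK ?fin_num_measure //.
rewrite -[P (A `&` B)]fineK ?fin_num_measure //.
rewrite -!EFinB -EFinD !lee_fin.
by move: (fine _) (fine _) (fine _) => x y z; lra.
Qed.

(** * Law of the sign pattern of the noise *)

Section sign_patterns.
Context (d : measure_display) (T : measurableType d) (R : realType).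
Context (P : probability T R) (m : nat) (z : T -> 'cV[R]_m).

Definition pattern_prob (i : 'I_m) (s : option bool) : R :=
  fine (P ((fun w => z w i 0) @^-1` ((@sign_pattern R) @^-1` [set s]))).

Definition pattern_event (f : {ffun 'I_m -> option bool}) : set T :=
  [set w | forall i, sign_pattern (z w i 0) = f i].

Lemma pattern_eventE f : pattern_event f =
  \bigcap_(i in [set` [set: 'I_m]%SET])
    ((fun w => z w i 0) @^-1` ((@sign_pattern R) @^-1` [set f i])).
Proof.
by apply/seteqP; split=> w /= wf i => [_|]; apply: wf; rewrite /= inE.
Qed.

Lemma sigma_mx_pattern_event f : sigma_mx z (pattern_event f).
Proof.
set G := \bigcup_(ij in [set: 'I_m * 'I_1]) g_sigma_algebra_preimage
  (fun w => z w ij.1 ij.2 : measurableTypeR R).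
rewrite pattern_eventE.
suff : G.-sigma.-measurable (\bigcap_(i in [set` [set: 'I_m]%SET])
    ((fun w => z w i 0) @^-1` ((@sign_pattern R) @^-1` [set f i]))) by [].
apply: fin_bigcap_measurable => // i _; rewrite -[X in measurable X]setTI.
apply: sigma_mx_entry => //; exact: measurable_sign_pattern.
Qed.

Lemma pattern_prob_ge0 i s : 0 <= pattern_prob i s.
Proof. exact: fine_ge0. Qed.

Context (mz : random_mx z).

Lemma measurable_entry_pattern i s :
  measurable ((fun w => z w i 0) @^-1` ((@sign_pattern R) @^-1` [set s])).
Proof.
rewrite -[X in measurable X]setTI; apply: (mz i 0) => //.
exact: measurable_sign_pattern.
Qed.

Lemma pattern_prob_sum i : \sum_s pattern_prob i s = 1.
Proof.
apply: (probability_fibers P (Y := fun w => sign_pattern (z w i 0))) => s.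
exact: measurable_entry_pattern.
Qed.

Lemma probability_pattern_event f :
  mutually_independent P (fun i w => z w i 0) ->
  P (pattern_event f) = (\prod_i pattern_prob i (f i))%:E.
Proof.
move=> indep; rewrite pattern_eventE (indep [set: 'I_m]%SET) => [|i]; last first.
  exact: measurable_sign_pattern.
rewrite -prodEFin; apply: eq_big => [i|i _]; first by rewrite inE.
rewrite fineK // fin_num_measure //; exact: measurable_entry_pattern.
Qed.

Lemma contaminated_pattern_prob (eps : R)
    (Q : probability (measurableTypeR R) R) i s :
  contaminated_law P (fun w => z w i 0) eps Q ->
  pattern_prob i s = (1 - eps) * (s == None)%:R +
    eps * fine (Q ((@sign_pattern R) @^-1` [set s])).
Proof.
move=> law; have mS := @measurable_sign_pattern R s.
rewrite /pattern_prob law // diracE.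
rewrite -[Q _]fineK ?fin_num_measure // -!EFinM -EFinD /=.
congr (_ * _%:R + _); rewrite /sign_pattern.
have -> : (0 \in (@sign_pattern R) @^-1` [set s]) = (s == None).
  by apply/idP/eqP => [/set_mem|->]; [|apply/mem_set];
    rewrite /= /sign_pattern eqxx.
by [].
Qed.

End sign_patterns.

(** * Exact recovery with high probability *)

Lemma sqrt_le_sqrt_mul_log (R : realType) (m k : nat) :
  (0 < k)%N -> (k <= m)%N ->
  Num.sqrt (k%:R / m%:R) <=
    Num.sqrt (k%:R / m%:R * ln (expR 1 * m%:R / k%:R)) :> R.
Proof.
move=> k0 km; apply: ler_wsqrtr; rewrite -[leLHS]mulr1.
apply: ler_wpM2l; first by rewrite divr_ge0.
rewrite -[leLHS]expRK -mulrA ler_ln ?posrE ?expR_gt0 //.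
  by rewrite ler_pMr ?expR_gt0 // ler_pdivlMr ?ltr0n // mul1r ler_nat.
by rewrite mulr_gt0 ?expR_gt0 // divr_gt0 ?ltr0n // (leq_trans k0).
Qed.

Theorem theorem3p1 (R : realType) :
  forall delta : R, 0 < delta < 1 ->
  exists delta0 : R, 0 < delta0 < 1 /\
  exists c : R, 0 < c /\
  forall (d : measure_display) (T : measurableType d) (P : probability T R)
    (m k : nat) (A : T -> 'M[R]_(m, k)) (z : T -> 'cV[R]_m)
    (ustar : 'cV[R]_k) (eta : T -> 'cV[R]_m) (uhat : T -> 'cV[R]_k)
    (eps : R) (Q : 'I_m -> probability (measurableTypeR R) R)
    (sigma lam_lo lam_hi : R),
  (0 < m)%N -> (0 < k)%N ->
  random_mx A -> random_mx z ->
  independent_mx P A z ->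
  0 <= eps < 1 ->
  mutually_independent P (fun i w => z w i 0) ->
  (forall i, contaminated_law P (fun w => z w i 0) eps (Q i)) ->
  (forall w, eta w = A w *m ustar + z w) ->
  (forall w, argmin (fun u : 'cV[R]_k => l1norm (eta w - A w *m u)) (uhat w)) ->
  0 <= sigma -> 0 < lam_lo -> 0 < lam_hi ->
  (forall a : 'I_m -> R, (forall i, `|a i| <= 1) ->
    prob_ge P
      [set w | l2norm (m%:R^-1 *: \sum_(i < m) a i *: (row i (A w))^T) ^+ 2
               <= sigma ^+ 2 * k%:R / m%:R]
      (1 - delta0)) ->
  prob_ge P
    [set w |
      (lam_lo%:E <=
         ereal_inf [set (m%:R^-1 *
                         \sum_(i < m) `|(row i (A w) *m D) 0 0|)%R%:E
                   | D in unit_sphere R k])%E /\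
      (ereal_sup [set (m%:R^-1 *
                       \sum_(i < m) `|(row i (A w) *m D) 0 0| ^+ 2)%R%:E
                 | D in unit_sphere R k]
         <= (lam_hi ^+ 2)%R%:E)%E]
    (1 - delta0) ->
  (lam_hi * Num.sqrt (k%:R / m%:R * ln (expR 1 * m%:R / k%:R))
     + eps * sigma * Num.sqrt (k%:R / m%:R))
    / (lam_lo * (1 - eps)) <= c ->
  prob_ge P [set w | uhat w = ustar] (1 - delta).
Proof.
(* The failures of (A) and (B) cost [delta / 4] each, which leaves [delta / 2] for the deviation of
   the slope. *)
move=> delta /andP[d0 d1]; exists (delta / 4); split; first by apply/andP; lra.
(* Multiplied by the Markov factor [4 / delta], this constant becomes 1/2, so the deviation uses at
   most half of [lam_lo * (1 - eps)]. *)
exists (delta / 8); split; first lra.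
move=> d T P m k A z ustar eta uhat eps Q sigma lam_lo lam_hi m0 k0 mA mz indep
  /andP[eps0 eps1] zindep law etaE uhatP sigma0 lo0 hi0 condA condB ratio.
pose p := pattern_prob P z.
pose q i s := fine (Q i ((@sign_pattern R) @^-1` [set s])).
(* The mean sign under [Q i]: a non-random coefficient in [-1, 1], to which (A) is applied. *)
pose a i := q i (Some true) - q i (Some false).
have pE i s : p i s = (1 - eps) * (s == None)%:R + eps * q i s.
  exact: contaminated_pattern_prob.
have q01 i s : 0 <= q i s <= 1.
  rewrite /q fine_ge0 //= -lee_fin fineK ?fin_num_measure //;
    try exact: measurable_sign_pattern.
  by apply: probability_le1; exact: measurable_sign_pattern.
have a1 i : `|a i| <= 1.
  have /andP[? ?] := q01 i (Some true); have /andP[? ?] := q01 i (Some false).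
  by rewrite /a ler_norml; apply/andP; split; lra.
have [FA [mFA FAP PFA]] := condA a a1.
have [FB [mFB FBP PFB]] := condB.
(* Otherwise the event of (B) would be empty, although its probability is at least 1 -
   [delta / 4]. *)
have km : (k <= m)%N.
  rewrite leqNgt; apply/negP => mk.
  have FB0 : FB = set0.
    rewrite -subset0 => w /FBP[inf _].
    by have := underdetermined_lam_le0 mk inf; rewrite leNgt lo0.
  by move: PFB; rewrite FB0 measure0 lee_fin; lra.
have m0R : 0 < m%:R :> R by rewrite ltr0n.
pose s : R := Num.sqrt (k%:R / m%:R).
have s0 : 0 < s by rewrite sqrtr_gt0 divr_gt0 // ltr0n.
have s2 : s ^+ 2 = k%:R / m%:R by rewrite sqr_sqrtr // divr_ge0.
(* [B] is the Frobenius bound that (B) provides, and [t] is chosen so that the tail bound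
   [2 * B / t] equals [delta / 2]. *)
pose B := m%:R * lam_hi * s; pose t := 4 / delta * B.
have B0 : 0 < B by rewrite !mulr_gt0.
have B2 : B ^+ 2 = m%:R * k%:R * lam_hi ^+ 2.
  by rewrite !exprMn s2; field; rewrite gt_eqF.
have t0 : 0 < t by rewrite mulr_gt0 // divr_gt0.
have tm : m%:R^-1 * t < (1 - eps) * lam_lo - eps * (sigma * s).
  have -> : m%:R^-1 * t = 4 / delta * (lam_hi * s).
    by rewrite /t /B; field; rewrite !gt_eqF.
  move: ratio; rewrite ler_pdivrMr; last by rewrite mulr_gt0 // subr_gt0.
  have : lam_hi * s <= lam_hi * Num.sqrt (k%:R / m%:R * ln (expR 1 * m%:R / k%:R)).
    by apply: ler_wpM2l; [exact: ltW|exact: sqrt_le_sqrt_mul_log].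
  rewrite -/s -[eps * sigma * s]mulrA.
  move: (lam_hi * Num.sqrt _) (lam_hi * s) => L l lL ratio.
  have es0 : 0 <= eps * (sigma * s) by rewrite !mulr_ge0 // ltW.
  move: (eps * (sigma * s)) es0 ratio => e e0 ratio.
  have lo1 : 0 < lam_lo * (1 - eps) by rewrite mulr_gt0 // subr_gt0.
  have le : l + e <= delta / 8 * (lam_lo * (1 - eps)) by lra.
  have : 4 / delta * (l + e) <= lam_lo * (1 - eps) / 2.
    rewrite mulrAC ler_pdivrMr //; lra.
  have : e <= 4 / delta * e.
    by rewrite -{1}[e]mul1r; apply: ler_wpM2r => //; rewrite ler_pdivlMr //; lra.
  rewrite mulrDr; lra.
(* The exceptional event: the matrix is bad for the sign pattern that the noise actually has. *)
pose N := \bigcup_f (A @^-1` bad_matrix p B t f `&` pattern_event z f).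
have mD f : measurable (A @^-1` bad_matrix p B t f).
  by apply: sigma_mx_measurable mA _; exact: sigma_mx_bad_matrix.
have mE f : measurable (pattern_event z f).
  by apply: sigma_mx_measurable mz _; exact: sigma_mx_pattern_event.
have mN : measurable N.
  by apply: fin_bigcup_measurable => // f _; exact: measurableI.
have PN : (P N <= (delta / 2)%:E)%E.
  apply: (@probability_mixture_le _ _ _ P {ffun 'I_m -> option bool}
    (fun f => A @^-1` bad_matrix p B t f) (pattern_event z)
    (fun f => \prod_i p i (f i))) => //.
  - move=> f; apply: indep; first exact: sigma_mx_bad_matrix.
    exact: sigma_mx_pattern_event.
  - by move=> f; exact: probability_pattern_event.
  - by move=> f; apply: prodr_ge0 => i _; exact: pattern_prob_ge0.
  - move=> w.
    (* If the Frobenius bound fails, no pattern is bad for this matrix and the sum is empty;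
       otherwise the tail bound applies. *)
    have [AB|AB] := boolP (\sum_i \sum_j A w i j ^+ 2 <= B ^+ 2); last first.
      rewrite big_pred0 ?divr_ge0 ?ltW // => f; apply/negbTE/negP => /set_mem.
      by move=> [AB' _]; rewrite AB' in AB.
    have -> : delta / 2 = 2 * B / t.
      by rewrite /t; field; rewrite !gt_eqF.
    apply: (slope_dev_tail _ _ B0 AB t0).
    + by move=> i r; exact: pattern_prob_ge0.
    + by move=> i; exact: pattern_prob_sum.
    + by move=> f /set_mem[].
(* A measurable event inside the recovery event, which itself may fail to be measurable for an
   arbitrary choice of minimizers. *)
exists (FA `&` FB `&` ~` N); split.
- by apply: measurableI; [exact: measurableI|exact: measurableC].
- move=> w [[wA wB] wN] /=.
  have [inf sup] := FBP _ wB; have /= las := FAP _ wA.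
  have := uhatP w; rewrite etaE => minu.
  apply: (l1_recovery minu) => D D1.
  pose f := [ffun i => sign_pattern (z w i 0)].
  rewrite (eq_bigr (fun i => abs_slope (f i) ((A w *m D) i 0))); last first.
    by move=> i _; rewrite ffunE.
  apply: (sum_slope_gt0 (p := p) (eps := eps) (s := sigma * s) (t := t)
    (lam := lam_lo) (a := a) m0 D1 eps0 (ltW eps1)) => //.
  + by rewrite mulr_ge0 // ltW.
  + by move=> i; rewrite pE eqxx mulr1 lerDl mulr_ge0 //; case/andP: (q01 i None).
  + by move=> i; rewrite !pE /= /a; ring.
  + by rewrite exprMn s2 mulrA.
  + by rewrite -lee_fin; apply: (le_trans inf); apply: ereal_inf_lbound; exists D.
  (* A unit direction with deviation above [t] would put [w] in [N], since (B) provides the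
     Frobenius bound. *)
  + rewrite -[t]mulr1 -D1 leNgt; apply/negP => bad; apply: wN; exists f => //.
    split; last by move=> i; rewrite ffunE.
    split; last by exists D.
    by rewrite B2; exact: frobenius_le.
- have PNC : ((1 - delta / 2)%:E <= P (~` N))%E.
    move: PN; rewrite probability_setC // -[P N]fineK ?fin_num_measure //.
    by rewrite -EFinB !lee_fin; lra.
  have := probability_setI_ge (measurableI _ _ mFA mFB) (measurableC mN)
    (probability_setI_ge mFA mFB PFA PFB) PNC.
  by congr (_%:E <= _)%E; lra.
Qed.
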